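(* Suppose $G$ is a compactly generated totally disconnected locally compact group. Then $\mathrm{h}_G=\mathrm{F\o l}^\ast G$.
   Context: Let $\mu$ be a (left) Haar measure on $G$. For $G$ compactly generated, \[ \mathrm{F\o l}^\ast G=\inf_S\inf_U\frac{\mu(US\setminus U)}{\mu(U)}, \] where the infima are over all compact symmetric generating sets $S$ for $G$ and all compact subsets $U\subseteq G$ of positive measure. For a set $A$ of vertices of a graph $\Gamma$, $\partial A$ is the set of vertices not in $A$ that have a neighbour in $A$, and the Cheeger constant is $\mathrm{h}(\Gamma)=\inf |\partial A|/|A|$ over finite non-empty sets $A$ of vertices. All actions of topological groups on graphs are by graph automorphisms and continuous, i.e. the induced homomorphism $G\to\mathrm{Aut}(\Gamma)$ is continuous for the topology of pointwise convergence on $\mathrm{Aut}(\Gamma)$. An action is proper if vertex stabilisers are compact in $G$, and transitive if there is a unique orbit of vertices. Let $\mathfrak{G}$ be the set of isomorphism classes of connected, locally finite, vertex-transitive graphs, and let $\mathfrak{G}(G)\subseteq\mathfrak{G}$ be the subset of graphs admitting a proper transitive action of $G$. Define $\mathrm{h}_G=\inf_{\Gamma\in\mathfrak{G}(G)}\mathrm{h}(\Gamma)$. *)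

(* Defs.v *)
From HB Require Import structures.
From mathcomp Require Import all_boot all_order all_algebra.
From mathcomp Require Import all_classical all_reals all_analysis.

Set Implicit Arguments.
Unset Strict Implicit.
Unset Printing Implicit Defensive.

Import Num.Theory.
Local Open Scope ring_scope.
Local Open Scope classical_set_scope.
Local Open Scope ereal_scope.

(* [Pointed] is required by the measurable types of the library; it adds
   nothing here, since a group is inhabited. *)
HB.mixin Record isTopologicalGroup G of Group G & Topological G := {
  mulg_continuous : continuous (fun p : G * G => (p.1 * p.2)%g) ;
  invg_continuous : continuous (fun x : G => (x^-1)%g)
}.

#[short(type="topologicalGroupType")]
HB.structure Definition TopologicalGroup :=
  {G of Group G & Topological G & Pointed G & isTopologicalGroup G}.

(* Locally compact groups are Hausdorff by convention. *)
Definition tdlc (G : topologicalGroupType) : Prop :=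
  [/\ hausdorff_space G, locally_compact [set: G]
    & totally_disconnected [set: G]].

Definition subgroup_set (G : groupType) (H : set G) : Prop :=
  [/\ H 1%g, (forall x y, H x -> H y -> H (x * y)%g)
    & (forall x, H x -> H (x^-1)%g)].

Definition generates (G : groupType) (S : set G) : Prop :=
  smallest (@subgroup_set G) S = setT.

Definition symmetric_set (G : groupType) (S : set G) : Prop :=
  [set (x^-1)%g | x in S] = S.

Definition prodset (G : groupType) (A B : set G) : set G :=
  [set (a * b)%g | a in A & b in B].

Definition compactly_generated (G : topologicalGroupType) : Prop :=
  exists S : set G, compact S /\ generates S.

Definition borel (T : ptopologicalType) := g_sigma_algebraType (@open T).

(* A left Haar measure: a nonzero left-invariant Radon measure on the Borel
   sets (finite on compact sets, outer regular on Borel sets, inner regular on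
   open sets). *)
Definition left_haar (R : realType) (G : topologicalGroupType)
    (mu : {measure set (borel G) -> \bar R}) : Prop :=
  [/\ (mu setT != 0)%E,
      (forall (g : G) (A : set (borel G)), measurable A ->
         mu [set (g * a)%g | a in (A : set G)] = mu A),
      (forall K : set G, compact K -> (mu K < +oo)%E),
      (forall A : set (borel G), measurable A ->
         mu A = ereal_inf [set mu V | V in [set V : set G | open V /\ A `<=` V]])
    & (forall V : set G, open V ->
         mu V = ereal_sup [set mu K | K in [set K : set G | compact K /\ K `<=` V]])].

Definition folner_star (R : realType) (G : topologicalGroupType)
    (mu : {measure set (borel G) -> \bar R}) : \bar R :=
  ereal_inf
    [set ereal_inf
       [set (mu (prodset U S `\` U) / mu U)%E
         | U in [set U : set G | compact U /\ (0 < mu U)%E]]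
      | S in [set S : set G | [/\ compact S, symmetric_set S & generates S]]].

Record graph := Graph {
  vertex :> choiceType;
  adj : rel vertex;
  adj_sym : symmetric adj;
  adj_irr : irreflexive adj }.

Definition connected_graph (X : graph) : Prop :=
  forall x y : X, exists p : seq X, path (@adj X) x p /\ last x p = y.

Definition locally_finite (X : graph) : Prop :=
  forall x : X, finite_set [set y | adj x y].

Definition automorphism (X : graph) (f : X -> X) : Prop :=
  bijective f /\ forall x y, adj (f x) (f y) = adj x y.

(* Aut(X) with the topology of pointwise convergence: the subspace topology
   from X -> X, where the vertex set X is discrete. *)
Definition aut (X : graph) : topologicalType :=
  set_type [set f : {ptws X -> discrete_topology X} | automorphism (f : X -> X)].

Definition aut_fun (X : graph) (a : aut X) : X -> X := set_val a.

Definition orbit_of (I V : Type) (act : I -> V -> V) (v : V) : set V :=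
  [set act i v | i in setT].

Definition unique_orbit (I V : Type) (act : I -> V -> V) : Prop :=
  exists! O : set V, range (orbit_of act) O.

Definition vertex_transitive (X : graph) : Prop := unique_orbit (@aut_fun X).

(* A continuous action of G on X by graph automorphisms. *)
Definition graph_action (G : topologicalGroupType) (X : graph)
    (rho : G -> aut X) : Prop :=
  (forall g h : G, aut_fun (rho (g * h)%g) =1 aut_fun (rho g) \o aut_fun (rho h))
  /\ continuous rho.

Definition proper_action (G : topologicalGroupType) (X : graph)
    (rho : G -> aut X) : Prop :=
  forall v : X, compact [set g | aut_fun (rho g) v = v].

Definition transitive_action (G : topologicalGroupType) (X : graph)
    (rho : G -> aut X) : Prop :=
  unique_orbit (fun g => aut_fun (rho g)).

Definition vboundary (X : graph) (A : set X) : set X :=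
  [set y | ~ A y /\ exists2 x, A x & adj y x].

(* [counting] is the cardinality, +oo on infinite sets. *)
Definition cheeger (R : realType) (X : graph) : \bar R :=
  ereal_inf [set (counting (vboundary A) / counting A)%E
    | A in [set A : set X | finite_set A /\ A !=set0]].

(* Predicates on graphs rather than sets of isomorphism classes: both are
   isomorphism-invariant, as is the Cheeger constant. *)
Definition frakG (X : graph) : Prop :=
  [/\ connected_graph X, locally_finite X & vertex_transitive X].

Definition frakG_of (G : topologicalGroupType) (X : graph) : Prop :=
  frakG X /\ exists rho : G -> aut X,
    [/\ graph_action rho, proper_action rho & transitive_action rho].

Definition cheeger_group (R : realType) (G : topologicalGroupType) : \bar R :=
  ereal_inf [set h : \bar R |
    exists X : graph, frakG_of G X /\ h = cheeger R X].

(* Main.v *)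
Require Import Defs.
From mathcomp Require Import all_boot all_order all_algebra.
From mathcomp Require Import finmap generic_quotient ring.
From mathcomp Require Import all_classical all_reals all_analysis.

(** Finite sets of vertices correspond to compact open subsets of [G] with the
same ratio, and every compact subset of [G] of positive measure is approximated
by such sets.

Let [X] be a graph with a proper transitive continuous action of [G], and [o] a
vertex. Its stabiliser [H] is compact and open, and [g |-> g o] identifies the
vertices with the left cosets of [H]. The elements that move [o] to itself or
to a neighbour form a compact symmetric generating set [S]. If [U] is the
preimage of a finite set [A] of vertices, then [U S \ U] is exactly the
preimage of the boundary of [A]; as every fibre has measure [mu H], which is
positive and finite, the two ratios coincide ([haar_boundary_ratio]). Hence
every ratio that enters [cheeger_group] enters [folner_star]
([folner_le_cheeger]).

Conversely a pair [S], [U] need not come from a graph, because [U] and [S] need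
not be unions of cosets of an open subgroup. Outer regularity provides an open
[V] containing [U S] with [mu (V \ U S)] small. By van Dantzig's theorem
([compact_open_subgroup]) the compact open subgroups are a base at [1], so that
compactness of [U] and [S] yields such an [H] with [U H S H] inside [V]
([thicken_prodset]). The left cosets of [H], with [x H] adjacent to [y H] when
[x^-1 y] lies in [H S H] and the cosets differ, form a connected locally finite
graph on which [G] acts as required ([coset_graph_frakG]). The cosets that meet
[U] have preimage [U H], which contains [U], and the preimage of their boundary
lies in [V \ U]. The ratio in the graph is therefore at most the ratio of [S]
and [U] plus an arbitrarily small error ([cheeger_le_ratio]). *)

Set Implicit Arguments.
Unset Strict Implicit.
Unset Printing Implicit Defensive.

Import Order.TTheory GRing.Theory Num.Theory.

Local Open Scope ring_scope.
Local Open Scope classical_set_scope.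
Local Open Scope ereal_scope.

(** * Compact open neighbourhoods in totally disconnected spaces *)

Section compact_open.
Variable T : topologicalType.
Implicit Types (A B C D O K : set T) (DD : set (set T)).

Lemma closedD A O : closed A -> open O -> closed (A `\` O).
Proof.
by move=> cA oO; rewrite setDE; apply: closedI => //; exact: open_closedC.
Qed.

(** If no member of the family missed [C], the traces on [C] would generate a
proper filter; a cluster point in [C] would lie in every member. All the
compactness arguments of this part are instances. *)
Lemma compact_disjoint_directed C DD :
  compact C -> DD !=set0 -> (forall D, DD D -> closed D) ->
  (forall D E, DD D -> DD E -> exists2 F, DD F & F `<=` D `&` E) ->
  (forall x, C x -> exists2 D, DD D & ~ D x) ->
  exists2 D, DD D & D `&` C = set0.
Proof.
move=> cC [D0 DD0] clD dirD avoid; apply: contrapT => noD.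
have FF : ProperFilter (filter_from DD (fun D => D `&` C)).
  apply: filter_from_proper.
    apply: filter_from_filter; first by exists D0.
    move=> D E /dirD/[apply] -[F DDF FDE]; exists F => // x [/FDE[Dx Ex] Cx].
    by split.
  move=> D DDD; apply/set0P/eqP => DC0; apply: noD; exists D => //.
have [|x [Cx clx]] := cC _ FF; first by exists D0 => // x [].
have [D DDD] := avoid x Cx; apply; apply: (clD _ DDD) => N Nx.
have [|y [[Dy _] Ny]] := clx (D `&` C) N _ Nx; first by exists D.
by exists y.
Qed.

Lemma disjoint_open_closure (N O : set T) :
  open O -> N `&` O = set0 -> closure N `&` O = set0.
Proof.
move=> oO NO; rewrite -subset0 => x [clN Ox].
by have [y] := clN O (open_nbhs_nbhs (conj oO Ox)); rewrite NO.
Qed.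

(** Two applications of [compact_disjoint_directed]: closures of neighbourhoods
of a point [a] of [A] shrink to [a], so one of them avoids [B]; then closures of
open sets around [B] leave out each point of [A], so one of them avoids [A]. *)
Lemma hausdorff_separate_compacts A B :
  hausdorff_space T -> compact A -> compact B -> A `&` B = set0 ->
  exists O1 O2, [/\ open O1, open O2, A `<=` O1, B `<=` O2 & O1 `&` O2 = set0].
Proof.
move=> hT cA cB AB0.
have sep a : A a -> exists N, [/\ open N, N a & closure N `&` B = set0].
  move=> Aa.
  have [|||x Bx|_ [N [oN Na] <-]] := @compact_disjoint_directed B
      [set closure N | N in [set N | open N /\ N a]] cB.
  - by exists (closure setT), setT => //; split => //; exact: openT.
  - by move=> _ [N _ <-]; exact: closed_closure.
  - move=> _ _ [N [oN Na] <-] [M [oM Ma] <-].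
    exists (closure (N `&` M)); last exact: closureI.
    by exists (N `&` M) => //; split; [exact: openI|by split].
  - have /eqP ax : a <> x.
      by move=> ax; rewrite -[False]/(set0 x) -AB0 -ax; split; rewrite // ax.
    move: hT; rewrite open_hausdorff => /(_ _ _ ax)[[M N]] /=.
    rewrite !inE => -[Ma Nx] [oM oN MN0].
    exists (closure M); first by exists M.
    move=> clM; have := disjoint_open_closure oN MN0.
    by rewrite -subset0 => /(_ x); apply.
  - by exists N.
have [|||a Aa|_ [ O [oO BO] <-] OA0] := @compact_disjoint_directed A
    [set closure O | O in [set O | open O /\ B `<=` O]] cA.
- by exists (closure setT), setT => //; split => //; exact: openT.
- by move=> _ [N _ <-]; exact: closed_closure.
- move=> _ _ [N [oN Na] <-] [M [oM Ma] <-].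
  exists (closure (N `&` M)); last exact: closureI.
  exists (N `&` M) => //; split; first exact: openI.
  by move=> x Bx; split; [exact: Na|exact: Ma].
- have [N [oN Na NB]] := sep a Aa.
  exists (closure (~` closure N)).
    exists (~` closure N) => //; split.
      by apply: closed_openC; exact: closed_closure.
    by move=> x Bx clx; rewrite -[False]/(set0 x) -NB.
  move=> cla; have : closure (~` closure N) `&` N = set0.
    apply: disjoint_open_closure => //; rewrite -subset0 => x [nx Nx].
    by apply: nx; exact: subset_closure.
  by rewrite -subset0 => /(_ a); apply.
- exists (~` closure O), O; split => //.
  + by apply: closed_openC; exact: closed_closure.
  + by move=> a Aa clO; rewrite -[False]/(set0 a) -OA0.
  + by rewrite -subset0 => x [nx Ox]; apply: nx; exact: subset_closure.
Qed.

(** In a compact neighbourhood [K] of [x], the quasi-component [Q] of [x] is the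
intersection of the relatively clopen subsets of [K] that contain [x]. It is
connected, because a splitting of [Q] into two closed pieces spreads to a
relatively clopen set by separation and compactness; so [Q] is reduced to [x].
By compactness, some relatively clopen set then lies in the interior of [K] and
of [N], and such a set is open in the whole space. *)
Lemma compact_open_nbhs (x : T) N :
  hausdorff_space T -> locally_compact [set: T] ->
  totally_disconnected [set: T] -> nbhs x N ->
  exists C, [/\ compact C, open C, C x & C `<=` N].
Proof.
move=> hT lcT tdT Nx.
have [K] := lcT x I; rewrite withinET => Kx [cK clK].
pose V := K° `&` N°.
have oV : open V by apply: openI; exact: open_interior.
have Vx : V x by split.
pose DD := [set D : set T | [/\ D x, D `<=` K, closed D & closed (K `\` D)]].
have DDK : DD K.
  split => //; first exact: nbhs_singleton.
  rewrite setDv; exact: closed0.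
have DDI D E : DD D -> DD E -> DD (D `&` E).
  move=> [Dx DK cD cKD] [Ex EK cE cKE]; split => //.
  - by move=> y [/DK].
  - exact: closedI.
  - by rewrite setDIr; exact: closedU.
have dirD D E : DD D -> DD E -> exists2 F, DD F & F `<=` D `&` E.
  by move=> DDD DDE; exists (D `&` E) => //; exact: DDI.
pose Q := \bigcap_(D in DD) D.
have Qx : Q x by move=> D [].
have QK : Q `<=` K by move=> y; apply.
have clQ : closed Q by apply: closed_bigI => D [].
have ctQ : connected Q.
  move=> A A0 [ O oO AO] [F clF AF].
  have clA : closed A by rewrite AF; exact: closedI.
  have clB : closed (Q `\` A).
    by rewrite AO setDIr setDv set0U; exact: closedD.
  have [[cA cB] AQ] : (compact A /\ compact (Q `\` A)) /\ A `<=` Q.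
    have AQ : A `<=` Q by rewrite AF => y [].
    split => //; split; apply: (subclosed_compact _ cK) => // y.
      by move=> /AQ/QK.
    by move=> [/QK].
  have [ O1 [ O2 [oO1 oO2 AO1 BO2 O120]]] :=
    hausdorff_separate_compacts hT cA cB (setDIK _ _).
  have [||y [Ky nOy]|D DDD DO] := @compact_disjoint_directed
    (K `\` (O1 `|` O2)) DD _ (ex_intro _ K DDK) _ dirD.
  - apply: (subclosed_compact _ cK); last by move=> y [].
    by apply: closedD => //; exact: openU.
  - by move=> D [].
  - apply: contrapT => nD; apply: nOy.
    have Qy : Q y by move=> D DDD; apply: contrapT => nDy; apply: nD; exists D.
    have [Ay|nAy] := pselect (A y); [left; exact: AO1|right; exact: BO2].
  - have DO12 y : D y -> O1 y \/ O2 y.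
      have [Dx DK _ _] := DDD.
      move=> Dy; apply: contrapT => nO; rewrite -[False]/(set0 y) -DO.
      by split => //; split => //; exact: DK.
    have disj y : O1 y -> O2 y -> False.
      by move=> O1y O2y; rewrite -[False]/(set0 y) -O120.
    (* [P'] covers what [P] misses in [D], so that [D `&` P] is closed although
       [P] is only known to be open. *)
    have part (P P' : set T) : open P -> open P' ->
        (forall y, D y -> P y \/ P' y) -> (forall y, P y -> P' y -> False) ->
        P x -> DD (D `&` P).
      move=> oP oP' DPP' PP' Px; have [Dx DK clD cKD] := DDD; split => //.
      - by move=> y [/DK].
      - rewrite (_ : D `&` P = D `\` P'); first exact: closedD.
        apply/seteqP; split => y [Dy].
          by move=> Py; split => // /(PP' _ Py).
        by case: (DPP' _ Dy).
      - rewrite setDIr; apply: closedU => //.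
        by apply: closedD.
    case: (DO12 x (Qx _ DDD)) => [ O1x|O2x].
    + have QO1 : Q `<=` O1.
        by move=> y /(_ _ (part _ _ oO1 oO2 DO12 disj O1x)) [].
      apply/seteqP; split => // y Qy; apply: contrapT => nAy.
      by apply: (disj y); [exact: QO1|exact: BO2].
    + have QO2 : Q `<=` O2.
        move=> y /(_ (D `&` O2)) []//; apply: (part _ O1) => //.
          by move=> z /DO12 [ O1z|O2z]; [right|left].
        by move=> z O2z O1z; exact: (disj z).
      have [a Aa] := A0.
      by exfalso; apply: (disj a); [exact: AO1|apply: QO2; exact: AQ].
have Qsub : Q `<=` [set x].
  by rewrite -(tdT x I) => y Qy; exists Q.
have [||y [Ky nVy]|D DDD DV] := @compact_disjoint_directed
  (K `\` V) DD _ (ex_intro _ K DDK) _ dirD.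
- by apply: (subclosed_compact _ cK); [exact: closedD|move=> y []].
- by move=> D [].
- apply: contrapT => nD; apply: nVy.
  have -> // : y = x.
  apply: Qsub => D DDD; apply: contrapT => nDy; apply: nD; by exists D.
- have [Dx DK clD cKD] := DDD.
  have DsV : D `<=` V.
    move=> y Dy; apply: contrapT => nVy; rewrite -[False]/(set0 y) -DV.
    by split => //; split => //; exact: DK.
  exists D; split => //.
  + exact: (subclosed_compact clD cK).
  + rewrite (_ : D = V `\` (K `\` D)).
      by rewrite setDE; apply: openI => //; exact: closed_openC.
    apply/seteqP; split => y.
      by move=> Dy; split; [exact: DsV|move=> []].
    move=> [Vy nKD]; apply: contrapT => nDy; apply: nKD; split => //.
    by apply: interior_subset; case: Vy.
  + by move=> y /DsV [_] /interior_subset.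
Qed.

End compact_open.

(** * Compact open subgroups *)

Section topological_groups.
Variable G : topologicalGroupType.
Implicit Types (H K N U V S : set G).

Lemma cvg_mulg (T : Type) (F : set_system T) (f g : T -> G) (a b : G) :
  Filter F -> f @ F --> a -> g @ F --> b ->
  (fun t => f t * g t)%g @ F --> (a * b)%g.
Proof.
move=> FF.
exact: (@continuous2_cvg T G G G F FF f g (fun x y => x * y)%g a b
  (mulg_continuous (a, b))).
Qed.

Lemma lmulg_continuous (a : G) : continuous (fun x => a * x)%g.
Proof. by move=> x; apply: cvg_mulg; [exact: cvg_cst|exact: cvg_id]. Qed.

Lemma nbhs1_translate (x : G) (N : set G) :
  nbhs 1%g N -> \forall y \near x, N (x^-1 * y)%g.
Proof.
move=> nN; have : (fun y => x^-1 * y)%g @ x --> (x^-1 * x)%g.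
  exact: (@lmulg_continuous (x^-1)%g).
by rewrite mulVg; apply.
Qed.

Lemma subgroup_open H : subgroup_set H -> nbhs 1%g H -> open H.
Proof.
move=> [H1 HM HV] nH; rewrite openE => x Hx.
have := nbhs1_translate x nH; apply: filterS => y /(HM _ _ Hx).
by rewrite mulVKg.
Qed.

Lemma subgroup_closed H : subgroup_set H -> open H -> closed H.
Proof.
move=> [H1 HM HV] oH x clHx.
have nH : nbhs 1%g H by exact: open_nbhs_nbhs.
have /clHx := nbhs1_translate x nH; case=> y [Hy Hxy].
by rewrite -[x]invgK -[(x^-1)%g](mulgK y); apply/HV/HM => //; exact: HV.
Qed.

(** Van Dantzig's theorem. Given a compact open [C] with [1] in [C] and [C]
inside [N], the subgroup is the right stabiliser of [C], that is, the set of
[g] with [C g = C]: it lies in [C] because [1] does, and it contains a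
neighbourhood of [1] because [C] is compact and open. *)
Lemma compact_open_subgroup N :
  tdlc G -> nbhs 1%g N ->
  exists H, [/\ subgroup_set H, compact H, open H & H `<=` N].
Proof.
move=> [hG lcG tdG] nN.
have [C [cC oC C1 CN]] := compact_open_nbhs hG lcG tdG nN.
pose W := [set g | forall c, C c -> C (c * g)%g].
have nW : nbhs 1%g W.
  have /compact_near_coveringP cov := cC.
  apply: (cov G (nbhs 1%g) (fun g c => C (c * g)%g)) => c Cc.
  have : (fun p : G * G => p.1 * p.2)%g @ (c, 1%g) --> (c * 1)%g.
    exact: (mulg_continuous (c, 1%g)).
  by rewrite mulg1; apply; exact: open_nbhs_nbhs.
have nW' : nbhs 1%g [set g | W g^-1%g].
  have : (fun g : G => g^-1)%g @ 1%g --> (1^-1)%g by exact: invg_continuous.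
  by rewrite invg1; apply.
pose H := [set g | W g /\ W g^-1%g].
have sH : subgroup_set H.
  split.
  - by split => c; rewrite ?invg1 mulg1.
  - move=> x y [Wx Wx'] [Wy Wy']; split => c Cc.
      by rewrite mulgA; apply/Wy/Wx.
    by rewrite invgM mulgA; apply/Wx'/Wy'.
  - by move=> x [Wx Wx']; split => //; rewrite invgK.
have HC : H `<=` C by move=> g [/(_ _ C1)]; rewrite mul1g.
have oH : open H by apply: subgroup_open => //; exact: filterI.
exists H; split => //.
- by apply: (subclosed_compact _ cC) => //; exact: subgroup_closed.
- exact: subset_trans CN.
Qed.

Lemma prodset_compact U S : compact U -> compact S -> compact (prodset U S).
Proof.
move=> cU cS.
have -> : prodset U S = (fun p : G * G => p.1 * p.2)%g @` (U `*` S).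
  apply/seteqP; split => [_ [u Uu [s Ss <-]]|_ [[u s] [/= Uu Ss] <-]].
    by exists (u, s).
  by exists u => //; exists s.
apply: continuous_compact; last exact: compact_setX.
exact/continuous_subspaceT/mulg_continuous.
Qed.

(** At [h = k = 1] the product [u h s k] lies in the open set [V] for all [u] and
[s]; compactness of [U * S] makes the neighbourhood of [(1, 1)] uniform. *)
Lemma thicken_prodset U S V : compact U -> compact S -> open V ->
  prodset U S `<=` V -> exists2 N, nbhs 1%g N &
    forall u h s k, U u -> N h -> S s -> N k -> V (u * h * s * k)%g.
Proof.
move=> cU cS oV USV.
have /compact_near_coveringP cov := compact_setX cU cS.
have [[u s] /= [Uu Ss]|[A B] /= [nA nB] AB] := cov (G * G)%type
    (nbhs (1%g, 1%g))
    (fun hk us => V (us.1 * hk.1 * us.2 * hk.2)%g) _.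
  pose z : (G * G) * (G * G) := ((u, s), (1%g, 1%g)).
  have cf : (fun p : (G * G) * (G * G) =>
        p.1.1 * p.2.1 * p.1.2 * p.2.2)%g @ z --> (u * 1 * s * 1)%g.
    repeat apply: cvg_mulg.
    - exact: (cvg_comp _ _ cvg_fst cvg_fst).
    - exact: (cvg_comp _ _ cvg_snd cvg_fst).
    - exact: (cvg_comp _ _ cvg_fst cvg_snd).
    - exact: (cvg_comp _ _ cvg_snd cvg_snd).
  apply: cf; apply: open_nbhs_nbhs; split => //.
  by rewrite !mulg1; apply: USV; exists u => //; exists s.
exists (A `&` B); first exact: filterI.
move=> u h s k Uu [Ah _] Ss [_ Bk].
exact: (AB (h, k) (conj Ah Bk) (u, s) (conj Uu Ss)).
Qed.

End topological_groups.

(** * Haar measure of unions of cosets *)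

Lemma borel_open (G : topologicalGroupType) (V : set (borel G)) :
  open (V : set G) -> measurable V.
Proof. by move=> oV; apply: sub_sigma_algebra. Qed.

Lemma borel_closed (G : topologicalGroupType) (V : set (borel G)) :
  closed (V : set G) -> measurable V.
Proof.
move=> cV; rewrite -[V]setCK; apply: measurableC; apply: borel_open.
exact: closed_openC.
Qed.

Lemma counting_gt0 (R : realType) (X : choiceType) (A : set X) :
  finite_set A -> A !=set0 -> 0 < counting A :> \bar R.
Proof.
move=> fA [a Aa]; rewrite /counting asboolT // lte_fin ltr0n cardfs_gt0.
by apply/fset0Pn; exists a; rewrite in_fset_set // inE.
Qed.

Section coset_maps.
Variables (G : topologicalGroupType) (H : set G) (X : choiceType) (q : G -> X).

(** [q] presents [X] as the set of left cosets of [H]. This covers both uses: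
the orbit map of a transitive action and the quotient map of [G]. *)
Definition coset_map :=
  (forall x y, q x = q y <-> H (x^-1 * y)%g) /\ (forall v, exists x, q x = v).

Hypotheses (sH : subgroup_set H) (oH : open H) (cH : compact H).
Hypothesis qH : coset_map.

Lemma coset_map_open A : open (q @^-1` A).
Proof.
have [qE _] := qH.
rewrite openE => x /= Ax.
have [H1 _ _] := sH.
have := nbhs1_translate x (open_nbhs_nbhs (conj oH H1)); apply: filterS => y.
by move=> /qE; rewrite /preimage /= => <-.
Qed.

Lemma coset_map_fiber x : q @^-1` [set q x] = [set (x * h)%g | h in H].
Proof.
have [qE _] := qH.
apply/seteqP; split => [y /= /esym/qE Hxy|_ [h Hh <-]] /=.
  by exists (x^-1 * y)%g => //; rewrite mulVKg.
by apply/esym/qE; rewrite mulKg.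
Qed.

Lemma preimage_fibers A : q @^-1` A = \bigcup_(v in A) (q @^-1` [set v]).
Proof. by apply/seteqP; split => [x Ax|x [v Av /= ->//]]; exists (q x). Qed.

(** The fibres of [q] are an open cover of [K]. *)
Lemma coset_map_finite_image K : compact K -> finite_set (q @` K).
Proof.
rewrite compact_cover => /(_ X setT (fun v => q @^-1` [set v])).
move=> []; [by move=> v _; exact: coset_map_open|by move=> x _; exists (q x)|].
move=> D _ KD; apply: (sub_finite_set _ (finite_fset D)) => _ [x Kx <-].
by have [v Dv /= ->] := KD x Kx.
Qed.

Lemma coset_map_preimage_compact A : finite_set A -> compact (q @^-1` A).
Proof.
move=> fA; rewrite preimage_fibers -bigsetU_fset_set //.
apply: bigsetU_compact => v _.
have [_ /(_ v)[x xv]] := qH; rewrite -xv coset_map_fiber.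
apply: continuous_compact => //.
exact/continuous_subspaceT/lmulg_continuous.
Qed.

Variables (R : realType) (mu : {measure set (borel G) -> \bar R}).
Hypothesis muH : left_haar mu.

Lemma haar_coset_preimage A : finite_set A ->
  mu (q @^-1` A) = counting A * mu H.
Proof.
move=> fA.
have [_ linv _ _ _] := muH.
rewrite preimage_fibers measure_fin_bigcup //; last 2 first.
- by move=> u v _ _ [x [/= -> ->]].
- by move=> v _; apply: borel_open; exact: coset_map_open.
have -> : \sum_(v \in A) mu (q @^-1` [set v]) = \sum_(v \in A) mu H.
  apply: eq_fsbigr => v _; have [_ /(_ v)[x <-]] := qH.
  by rewrite coset_map_fiber (linv x H) //; exact: borel_open.
rewrite /counting asboolT // mule_natl fsbig_finite //= big_const_seq.
by rewrite count_predT iter_addr_0.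
Qed.

Hypothesis hG : hausdorff_space G.

(** A compact set is covered by finitely many left translates of [H]; if [H]
were null, inner regularity would make [mu] zero. *)
Lemma haar_open_subgroup_gt0 : 0 < mu H.
Proof.
rewrite lt0e measure_ge0 andbT; apply/negP => /eqP muH0.
have [/eqP muT _ _ _ inner] := muH.
apply: muT; apply/eqP; rewrite eq_le measure_ge0 andbT.
rewrite (inner setT openT); apply: ge_ereal_sup => _ [K [cK _] <-].
have <- : mu (q @^-1` (q @` K)) = 0.
  by rewrite haar_coset_preimage ?muH0 ?mule0 //; exact: coset_map_finite_image.
apply: le_measure; rewrite ?inE.
- by apply: borel_closed; exact: compact_closed.
- by apply: borel_open; exact: coset_map_open.
- by move=> x Kx; exists x.
Qed.

Lemma haar_coset_preimage_gt0 A : finite_set A -> A !=set0 ->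
  0 < mu (q @^-1` A).
Proof.
move=> fA A0; rewrite haar_coset_preimage //.
by apply: mule_gt0; [exact: counting_gt0|exact: haar_open_subgroup_gt0].
Qed.

Lemma haar_coset_ratio A B : finite_set A -> A !=set0 -> finite_set B ->
  mu (q @^-1` B) / mu (q @^-1` A) = counting B / counting A.
Proof.
move=> fA A0 fB; rewrite !haar_coset_preimage //.
have := haar_open_subgroup_gt0.
have : mu H < +oo by have [_ _ + _ _] := muH; apply.
case: (mu H) => [h||] // _; rewrite lte_fin => h0.
have := counting_gt0 R fA A0; rewrite /counting !asboolT // lte_fin => a0.
rewrite -!EFinM !inver !gt_eqF ?mulr_gt0 // -!EFinM.
by congr EFin; field; rewrite !lt0r_neq0.
Qed.

End coset_maps.

(** * Proper transitive actions on graphs *)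

(** Evaluation at [v] is continuous for pointwise convergence, and the set of
vertices is discrete. *)
Lemma open_move_to (X : graph) (v w : X) :
  open [set a : aut X | aut_fun a v = w].
Proof.
exists [set f : {ptws X -> discrete_topology X} | f v = w] => //.
pose pv (f : {ptws X -> discrete_topology X}) : discrete_topology X := f v.
have cv : continuous pv.
  exact: (@proj_continuous X (fun=> discrete_topology X) v).
by have := iffLR (continuousP pv) cv [set w] (discrete_open _); apply.
Qed.

Lemma aut_fun_automorphism (X : graph) (a : aut X) : automorphism (aut_fun a).
Proof. exact: set_valP a. Qed.

Lemma unique_orbitT (I V : Type) (a : I -> V -> V) (v0 : V) :
  (forall v w, exists i, a i v = w) -> unique_orbit a.
Proof.
move=> tr.
have orbT v : orbit_of a v = setT.
  by apply/seteqP; split => // w _; have [i iv] := tr v w; exists i.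
exists setT; split; first by exists v0.
by move=> _ [v _ <-]; rewrite orbT.
Qed.

Lemma vboundary_finite (X : graph) (A : set X) :
  locally_finite X -> finite_set A -> finite_set (vboundary A).
Proof.
move=> lfX fA.
apply: (@sub_finite_set _ _ (\bigcup_(v in A) [set y | adj v y])).
  by move=> y [_ [x Ax yx]]; exists x => //=; rewrite adj_sym.
by apply: bigcup_finite => // v _; exact: lfX.
Qed.

Section graph_actions.
Variables (G : topologicalGroupType) (X : graph) (rho : G -> aut X).
Hypotheses (act : graph_action rho) (prp : proper_action rho).
Hypothesis tr : transitive_action rho.
Variable o : X.

Let q g := aut_fun (rho g) o.
Let H := [set g | q g = o].

Lemma graph_actionM g h v :
  aut_fun (rho (g * h)%g) v = aut_fun (rho g) (aut_fun (rho h) v).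
Proof. by have [-> _] := act. Qed.

Lemma graph_action1 v : aut_fun (rho 1%g) v = v.
Proof.
have [/bij_inj inj _] := aut_fun_automorphism (rho 1%g).
by apply: inj; rewrite -graph_actionM mulg1.
Qed.

Lemma graph_actionK g v : aut_fun (rho g^-1%g) (aut_fun (rho g) v) = v.
Proof. by rewrite -graph_actionM mulVg graph_action1. Qed.

Lemma graph_action_adj g v w :
  adj (aut_fun (rho g) v) (aut_fun (rho g) w) = adj v w.
Proof. by have [_ ->] := aut_fun_automorphism (rho g). Qed.

Lemma transitive_actionP v w : exists g, aut_fun (rho g) v = w.
Proof.
have [B [_ uB]] := tr.
have Bv : B = orbit_of (fun g => aut_fun (rho g)) v by apply: uB; exists v.
have Bw : B = orbit_of (fun g => aut_fun (rho g)) w by apply: uB; exists w.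
have : B w by rewrite Bw; exists 1%g => //; exact: graph_action1.
by rewrite Bv => -[g _ gvw]; exists g.
Qed.

Lemma stabiliser_subgroup : subgroup_set H.
Proof.
split; rewrite /H /q /=.
- exact: graph_action1.
- by move=> x y xo yo; rewrite graph_actionM yo.
- by move=> x xo; rewrite -{1}xo graph_actionK.
Qed.

Lemma stabiliser_open : open H.
Proof.
have [_ crho] := act.
exact: (iffLR (continuousP rho) crho _ (open_move_to o o)).
Qed.

Lemma stabiliser_compact : compact H.
Proof. exact: prp. Qed.

Lemma orbit_coset_map : coset_map H q.
Proof.
split=> [x y|v]; last exact: transitive_actionP.
rewrite /H /q /= graph_actionM; split=> [<-|xyo].
  exact: graph_actionK.
by rewrite -{1}xyo -graph_actionM mulgV graph_action1.
Qed.

(** When [X] has a single vertex no element moves [o] to a neighbour; the elements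
that fix [o] are included so that the set generates [G] in that case too. *)
Definition neighbour_elements := [set g | q g = o \/ adj o (q g)].
Local Notation S := neighbour_elements.

(** For [g o] in [A] and [s] in [neighbour_elements], [g s o] is [g o] or one of its
neighbours, and every neighbour arises in this way. *)
Lemma prodset_neighbour_elements (A : set X) :
  prodset (q @^-1` A) S `\` q @^-1` A = q @^-1` vboundary A.
Proof.
apply/seteqP; split => [_ [[u /= Au [s So <-]] nAus]|y /= [nAy [v Av yv]]].
  split => //; exists (q u) => //.
  rewrite adj_sym /q graph_actionM graph_action_adj.
  case: So => // so; exfalso; apply: nAus.
  by rewrite /preimage/= /q graph_actionM -/(q s) so.
have [u uv] := transitive_actionP o v.
split => //; exists u; first by rewrite /= /q uv.
exists (u^-1 * y)%g; last by rewrite mulVKg.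
by right; rewrite -(graph_action_adj u) uv /q -graph_actionM mulVKg adj_sym.
Qed.

Lemma neighbour_elements_symmetric : symmetric_set S.
Proof.
have SV g : S g -> S g^-1%g.
  move=> [go|og]; [left|right].
    by rewrite /q -{1}go graph_actionK.
  by rewrite -(graph_action_adj g) -graph_actionM mulgV graph_action1 adj_sym.
apply/seteqP; split => [_ [g Sg <-]|g Sg]; first exact: SV.
by exists g^-1%g; [exact: SV|rewrite invgK].
Qed.

Lemma neighbour_elements_compact : locally_finite X -> compact S.
Proof.
move=> lfX.
have -> : S = q @^-1` (o |` [set y | adj o y]).
  by apply/seteqP; split => g [|]; by [left|right].
apply: (coset_map_preimage_compact stabiliser_compact orbit_coset_map).
by rewrite finite_setU; split => //; exact: finite_set1.
Qed.

(** Along a path from [o] to [g o], write the successive vertices as [g_i o];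
each [g_i^-1 g_(i+1)] moves [o] to a neighbour. The last step absorbs the
stabiliser. *)
Lemma neighbour_elements_generate : connected_graph X -> generates S.
Proof.
move=> cX; apply/seteqP; split => // g _ K [[K1 KM KV] SK].
have walk p : forall x y, path (@adj X) (q x) p -> last (q x) p = q y ->
    K x -> K y.
  elim: p => [|v p IH] x y /=.
    move=> _ /orbit_coset_map.1 Hxy Kx.
    by rewrite -(mulVKg x y); apply: KM => //; apply: SK; left.
  move=> /andP[xv vp] vy Kx.
  have [z zv] := transitive_actionP o v; rewrite -/(q z) in zv.
  apply: (IH z) => //; rewrite ?zv //.
  rewrite -(mulVKg x z); apply: KM => //; apply: SK; right.
  by rewrite -(graph_action_adj x) -graph_actionM mulVKg -/(q z) zv.
have [p [pp pg]] := cX (q 1%g) (q g).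
exact: walk pp pg K1.
Qed.

End graph_actions.

(** * The graph of left cosets of a compact open subgroup *)

Section coset_graph.
Local Open Scope quotient_scope.
Variables (G : topologicalGroupType) (H S : set G).
Hypotheses (sH : subgroup_set H).

Definition same_coset : rel G := fun x y => `[< H (x^-1 * y)%g >].

Lemma same_coset_refl : reflexive same_coset.
Proof. by move=> x; apply/asboolP; rewrite mulVg; have [] := sH. Qed.

Lemma same_coset_sym : symmetric same_coset.
Proof.
have [_ _ HV] := sH.
by move=> x y; apply/asboolP/asboolP => /HV; rewrite invgM invgK.
Qed.

Lemma same_coset_trans : transitive same_coset.
Proof.
have [_ HM _] := sH.
move=> y x z /asboolP xy /asboolP yz; apply/asboolP.
by rewrite -(mulVKg y z) mulgA; apply: HM.
Qed.

Definition coset_equiv :=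
  EquivRel same_coset same_coset_refl same_coset_sym same_coset_trans.
Definition left_cosets : choiceType := {eq_quot coset_equiv}.
Definition coset_of (x : G) : left_cosets := \pi_({eq_quot coset_equiv}) x.

Lemma coset_of_map : coset_map H coset_of.
Proof.
split=> [x y|v]; last by exists (repr v); rewrite /coset_of reprK.
split=> [/eqmodP/asboolP //|Hxy]; apply/eqmodP; exact/asboolP.
Qed.


Hypothesis SV : forall x, S x -> S (x^-1)%g.
Hypothesis HSH : forall h s k, H h -> S s -> H k -> S (h * s * k)%g.

(** The condition on representatives depends only on the cosets, since [S] is a
union of double cosets of [H]; see [coset_adjE]. *)
Definition coset_adj : rel left_cosets := fun u v =>
  (u != v) && `[< S ((repr u)^-1 * repr v)%g >].

Lemma coset_adjE x y :
  coset_adj (coset_of x) (coset_of y) =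
  (coset_of x != coset_of y) && `[< S (x^-1 * y)%g >].
Proof.
have [_ HM HV] := sH; have [qE _] := coset_of_map.
have rep z : H (z^-1 * repr (coset_of z))%g.
  by apply/qE; rewrite /coset_of reprK.
congr (_ && _); set x' := repr _; set y' := repr _.
have xx' : H (x^-1 * x')%g by exact: rep.
have yy' : H (y^-1 * y')%g by exact: rep.
apply: asbool_equiv_eq; split => Sxy.
- have -> : (x^-1 * y = (x^-1 * x') * (x'^-1 * y') * (y^-1 * y')^-1)%g.
    by rewrite invgM invgK !mulgA !mulgK.
  by apply: HSH => //; exact: HV.
- have -> : (x'^-1 * y' = (x^-1 * x')^-1 * (x^-1 * y) * (y^-1 * y'))%g.
    by rewrite invgM invgK !mulgA !mulgK.
  by apply: HSH => //; exact: HV.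
Qed.

Lemma coset_adj_sym : symmetric coset_adj.
Proof.
move=> u v; rewrite /coset_adj eq_sym; congr (_ && _).
by apply: asbool_equiv_eq; split => /SV; rewrite invgM invgK.
Qed.

Lemma coset_adj_irr : irreflexive coset_adj.
Proof. by move=> u; rewrite /coset_adj eqxx. Qed.

Definition coset_graph : graph := Graph coset_adj_sym coset_adj_irr.

Definition coset_act (g : G) (u : coset_graph) : coset_graph :=
  coset_of (g * repr u)%g.

Lemma coset_actE g x : coset_act g (coset_of x) = coset_of (g * x)%g.
Proof.
have [qE _] := coset_of_map.
apply/qE; rewrite invgM !mulgA mulgVK; apply/qE.
by rewrite /coset_of reprK.
Qed.

Lemma coset_actM g h u : coset_act (g * h)%g u = coset_act g (coset_act h u).
Proof.
have [_ /(_ u)[x <-]] := coset_of_map.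
by rewrite !coset_actE mulgA.
Qed.

Lemma coset_act1 u : coset_act 1%g u = u.
Proof.
have [_ /(_ u)[x <-]] := coset_of_map.
by rewrite !coset_actE mul1g.
Qed.

Lemma coset_act_automorphism g : automorphism (coset_act g).
Proof.
have inj : bijective (coset_act g).
  exists (coset_act g^-1%g) => u;
    by rewrite -coset_actM (mulVg, mulgV) coset_act1.
split => // u v.
have [_ sq] := coset_of_map.
rewrite /adj/=; have [[x <-] [y <-]] := (sq u, sq v).
rewrite !coset_actE !coset_adjE -!coset_actE (inj_eq (bij_inj inj)).
by rewrite invgM !mulgA mulgVK.
Qed.

Definition coset_rho (g : G) : aut coset_graph :=
  exist _ (coset_act g : {ptws coset_graph -> discrete_topology coset_graph})
    (mem_set (coset_act_automorphism g)).

Lemma coset_rhoE g : aut_fun (coset_rho g) = coset_act g.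
Proof. by []. Qed.

Hypothesis oH : open H.

Lemma coset_graph_action : graph_action coset_rho.
Proof.
split=> [g h u|]; first by rewrite !coset_rhoE /= coset_actM.
apply: continuous_comp_initial => g.
apply/cvg_sup => v.
apply: (@continuous_comp_initial _ _ (discrete_topology coset_graph)
  (fun f : {ptws coset_graph -> discrete_topology coset_graph} => f v)).
apply/continuousP => A _.
have [_ /(_ v)[x xv]] := coset_of_map.
have cx : continuous (fun y : G => y * x)%g.
  by move=> y; apply: cvg_mulg; [exact: cvg_id|exact: cvg_cst].
have := iffLR (continuousP _) cx _ (coset_map_open sH oH coset_of_map A).
congr open; apply/funext => y.
by rewrite -[RHS]/(A (coset_act y v)) -xv coset_actE.
Qed.

Lemma coset_graph_moves u v : exists g, coset_act g u = v.
Proof.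
have [_ sq] := coset_of_map; have [[x <-] [y <-]] := (sq u, sq v).
by exists (y * x^-1)%g; rewrite coset_actE mulgVK.
Qed.

Lemma coset_rho_transitive : transitive_action coset_rho.
Proof. exact: unique_orbitT (coset_of 1%g) coset_graph_moves. Qed.

Hypotheses (cH : compact H).

(** The stabiliser of [x H] is the conjugate [x H x^-1]. *)
Lemma coset_rho_proper : proper_action coset_rho.
Proof.
move=> v; have [qE /(_ v)[x xv]] := coset_of_map.
have -> : [set g | aut_fun (coset_rho g) v = v] =
    [set y * x^-1 | y in [set x * h | h in H]]%g.
  apply/seteqP; split => [g /=|_ [_ [h Hh <-] <-] /=].
    rewrite coset_rhoE -xv coset_actE => /esym/qE Hg.
    exists (g * x)%g; last by rewrite mulgK.
    by exists (x^-1 * (g * x))%g => //; rewrite mulVKg.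
  by rewrite coset_rhoE -xv coset_actE mulgVK; apply/esym/qE; rewrite mulKg.
apply: continuous_compact.
  apply: continuous_subspaceT => y.
  by apply: cvg_mulg; [exact: cvg_id|exact: cvg_cst].
apply: continuous_compact => //.
exact/continuous_subspaceT/lmulg_continuous.
Qed.

Hypotheses (cS : compact S) (gS : generates S).

(** The neighbours of [x H] lie in the image of the compact set [x S]. *)
Lemma coset_graph_locally_finite : locally_finite coset_graph.
Proof.
move=> v; have [qE /(_ v)[x xv]] := coset_of_map.
have cxS : compact [set x * s | s in S]%g.
  apply: continuous_compact => //.
  exact/continuous_subspaceT/lmulg_continuous.
apply: sub_finite_set (coset_map_finite_image sH oH coset_of_map cxS) => w /=.
have [y yw] := coset_of_map.2 w; rewrite -xv -yw /adj /= coset_adjE.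
move=> /andP[_ /asboolP Sxy]; exists y => //.
by exists (x^-1 * y)%g => //; rewrite mulVKg.
Qed.

(** The elements [g] such that [x H] and [x g H] are always joined by a path
form a subgroup containing [S]. *)
Lemma coset_graph_connected : connected_graph coset_graph.
Proof.
pose linked (u v : coset_graph) :=
  exists p, path (@adj coset_graph) u p /\ last u p = v.
have linkedT u v w : linked u v -> linked v w -> linked u w.
  move=> [p [up pv]] [r [vr rw]]; exists (p ++ r).
  by rewrite cat_path last_cat pv up.
have linkedV u v : linked u v -> linked v u.
  move=> [p [up pv]]; exists (rev (belast u p)); rewrite -pv rev_path; split.
    by rewrite (eq_path (e' := @adj coset_graph)) // => a b; exact: adj_sym.
  by case: p {up pv} => //= a p; rewrite rev_cons last_rcons.
pose K := [set g : G | forall x, linked (coset_of x) (coset_of (x * g)%g)].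
have KT : K = setT.
  apply/seteqP; split => // g _; have : setT g by [].
  rewrite -gS; apply; split.
    split.
    - by move=> x; rewrite mulg1; exists [::].
    - by move=> a b Ka Kb x; rewrite mulgA; exact: linkedT (Ka _) (Kb _).
    - move=> a Ka x; apply: linkedV.
      by have := Ka (x * a^-1)%g; rewrite mulgVK.
  move=> s Ss x.
  have [xs|xs] := eqVneq (coset_of x) (coset_of (x * s)%g).
    by exists [::]; split.
  exists [:: coset_of (x * s)%g]; rewrite /= andbT; split => //.
  rewrite /adj /= coset_adjE xs mulKg; exact/asboolP.
move=> u v; have [_ sq] := coset_of_map; have [[x <-] [y <-]] := (sq u, sq v).
have : K (x^-1 * y)%g by rewrite KT.
by move=> /(_ x); rewrite mulVKg.
Qed.

Lemma coset_graph_frakG : frakG_of G coset_graph.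
Proof.
split; last first.
  exists coset_rho; split; [exact: coset_graph_action|exact: coset_rho_proper|].
  exact: coset_rho_transitive.
split; [exact: coset_graph_connected|exact: coset_graph_locally_finite|].
apply: (unique_orbitT (coset_of 1%g)) => u v.
by have [g guv] := coset_graph_moves u v; exists (coset_rho g).
Qed.

End coset_graph.

(** * Comparison of the two constants *)

Section comparison.
Variables (R : realType) (G : topologicalGroupType).
Variable mu : {measure set (borel G) -> \bar R}.
Hypotheses (tdG : tdlc G) (muH : left_haar mu).

Lemma hausdorffG : hausdorff_space G.
Proof. by have [] := tdG. Qed.

Lemma haar_boundary_ratio (X : graph) (rho : G -> aut X) (o : X) (A : set X) :
  graph_action rho -> proper_action rho -> transitive_action rho ->
  locally_finite X -> finite_set A -> A !=set0 ->
  let U := [set g | A (aut_fun (rho g) o)] in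
  mu (prodset U (neighbour_elements rho o) `\` U) / mu U =
  counting (vboundary A) / counting A.
Proof.
move=> act prp tr lfX fA A0 /=.
rewrite (prodset_neighbour_elements act tr).
have := haar_coset_ratio (stabiliser_subgroup act o) (stabiliser_open act o)
  (@stabiliser_compact _ _ _ prp o) (orbit_coset_map act tr o) muH
  hausdorffG fA A0 (vboundary_finite lfX fA).
by [].
Qed.

Lemma folner_le_cheeger : folner_star mu <= cheeger_group R G.
Proof.
apply: le_ereal_inf_tmp => _ [X [[[cX lfX _] [rho [act prp tr]]] ->]].
apply: le_ereal_inf_tmp => _ [A [fA A0] <-].
have [ o Ao] := A0.
rewrite -(haar_boundary_ratio o act prp tr) //.
apply: ge_ereal_inf; eexists.
  exists (neighbour_elements rho o) => //; split.
  - exact: neighbour_elements_compact.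
  - exact: neighbour_elements_symmetric.
  - exact: neighbour_elements_generate.
apply: ereal_inf_lbound.
exists [set g | A (aut_fun (rho g) o)] => //; split.
  exact: (coset_map_preimage_compact (@stabiliser_compact _ _ _ prp o)
    (orbit_coset_map act tr o) fA).
exact: (haar_coset_preimage_gt0 (stabiliser_subgroup act o)
  (stabiliser_open act o) (orbit_coset_map act tr o) muH hausdorffG fA A0).
Qed.

Lemma compact_borel (K : set G) : compact K -> measurable (K : set (borel G)).
Proof.
by move=> cK; apply: borel_closed; exact: compact_closed hausdorffG cK.
Qed.

Lemma haar_outer (K : set G) (e : R) : compact K -> (0 < e)%R ->
  exists V : set G, [/\ open V, K `<=` V & mu (V `\` K) <= e%:E].
Proof.
move=> cK e0; have [_ _ fin outer _] := muH.
have mK := compact_borel cK.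
have muK : mu K \is a fin_num by rewrite ge0_fin_numE //; exact: fin.
have : mu K < mu K + e%:E by rewrite lteDl // lte_fin.
rewrite {1}outer // => /ereal_inf_lt[_ [V [oV KV] <-] VK].
exists V; split => //.
have mV : measurable (V : set (borel G)) by exact: borel_open.
rewrite measureD ?setIidr //; last by exact: lt_le_trans VK (leey _).
by rewrite leeBlDr // addeC ltW.
Qed.

(** The vertex set is [G / H], with [H] so small that replacing [U] by [U H] and
[S] by [H S H] keeps the product inside an open set [V] barely larger than
[U S]. *)
Lemma cheeger_le_ratio (S U : set G) :
  compact S -> symmetric_set S -> generates S -> compact U -> 0 < mu U ->
  cheeger_group R G <= mu (prodset U S `\` U) / mu U.
Proof.
move=> cS symS gS cU U0; have [_ _ fin _ _] := muH.
have cUS := prodset_compact cU cS.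
have mU := compact_borel cU; have mUS := compact_borel cUS.
have mUSU : measurable (prodset U S `\` U : set (borel G)).
  exact: measurableD.
have [m mE] : exists m, mu U = m%:E.
  by exists (fine (mu U)); rewrite fineK // ge0_fin_numE //; exact: fin.
have [b bE] : exists b, mu (prodset U S `\` U) = b%:E.
  exists (fine (mu (prodset U S `\` U))).
  rewrite fineK // ge0_fin_numE //; apply: le_lt_trans (fin _ cUS).
  by apply: le_measure; rewrite ?inE // => x [].
have m0 : (0 < m)%R by rewrite -lte_fin -mE.
have b0 : (0 <= b)%R by rewrite -lee_fin -bE.
apply/lee_addgt0Pr => e e0.
(* The error is scaled by [m = mu U], so that it becomes [e] in the ratio. *)
have [|V [oV USV muV]] := haar_outer (e := e * m) cUS; first exact: mulr_gt0.
have [N nN NV] := thicken_prodset cU cS oV USV.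
have [H [sH cH oH HN]] := compact_open_subgroup tdG nN.
have [H1 HM HV] := sH.
pose S' := prodset (prodset H S) H.
have SV x : S x -> S (x^-1)%g by rewrite -{2}symS => Sx; exists x.
have cS' : compact S' by do 2 apply: prodset_compact => //.
have SS' : S `<=` S'.
  move=> s Ss; exists (1 * s)%g; first by exists 1%g => //; exists s.
  by exists 1%g => //; rewrite mul1g mulg1.
have S'V x : S' x -> S' (x^-1)%g.
  move=> [_ [h Hh [s Ss <-]] [k Hk <-]].
  exists (k^-1 * s^-1)%g.
    by exists k^-1%g; [exact: HV|exists s^-1%g => //; exact: SV].
  by exists h^-1%g; [exact: HV|rewrite !invgM mulgA].
have HS'H h x k : H h -> S' x -> H k -> S' (h * x * k)%g.
  move=> Hh [_ [h' Hh' [s Ss <-]] [k' Hk' <-]] Hk.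
  exists (h * h' * s)%g; first by exists (h * h')%g; [exact: HM|exists s].
  by exists (k' * k)%g; [exact: HM|rewrite !mulgA].
have gS' : generates S'.
  apply/seteqP; split => // g _ K [sK S'K].
  have : setT g by [].
  rewrite -gS; apply; split => //.
  exact: subset_trans S'K.
pose X := coset_graph sH S'V.
pose rho : G -> aut X := @coset_rho G H S' sH S'V HS'H.
have frX : frakG_of G X by exact: coset_graph_frakG.
have [_ lfX _] := frX.1.
have qH := coset_of_map sH.
pose A : set X := coset_of sH @` U.
have fA : finite_set A := coset_map_finite_image sH oH qH cU.
have A0 : A !=set0.
  apply/set0P/eqP => /image_set0_set0 UE.
  by move: U0; rewrite UE measure0 ltxx.
pose o : X := coset_of sH 1%g.
have rhoo g : aut_fun (rho g) o = coset_of sH g.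
  by rewrite /rho coset_rhoE /o coset_actE mulg1.
have act : graph_action rho by exact: coset_graph_action.
have prp : proper_action rho by exact: coset_rho_proper.
have tr : transitive_action rho by exact: coset_rho_transitive.
(* This is [U H]. *)
pose U' := [set g | A (aut_fun (rho g) o)].
pose D := prodset U' (neighbour_elements rho o) `\` U'.
have ratio : mu D / mu U' = counting (vboundary A) / counting A.
  exact: haar_boundary_ratio.
have UU' : U `<=` U' by move=> u Uu; rewrite /U' /= rhoo; exists u.
(* An element of [D] is [u k s] with [u] in [U], [k] in [H] and [s] in
   [H S H]: the alternative [s] in [H] would put it back into [U']. *)
have DVU : D `<=` V `\` U.
  move=> _ [[u' U'u' [s Ns <-]] nU'].
  split; last by move=> /UU'.
  move: U'u'; rewrite /U' /= rhoo => -[u Uu /qH.1 Huu'].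
  case: Ns => [|]; rewrite rhoo.
    move=> /esym/qH.1; rewrite invg1 mul1g => Hs; exfalso; apply: nU'.
    rewrite /U' /= rhoo; exists u => //; apply/qH.1.
    by rewrite mulgA; exact: HM.
  rewrite /adj /= coset_adjE // => /andP[_ /asboolP]; rewrite invg1 mul1g.
  move=> [_ [h Hh [t St <-]] [k Hk <-]].
  have -> : (u' * (h * t * k) = u * (u^-1 * u' * h) * t * k)%g.
    by rewrite !mulgA mulgV mul1g.
  by apply: NV => //; apply: HN => //; exact: HM.
have mD : measurable (D : set (borel G)).
  rewrite /D (prodset_neighbour_elements act tr).
  apply: borel_open.
  exact: (coset_map_open (stabiliser_subgroup act o) (stabiliser_open act o)
    (orbit_coset_map act tr o)).
have mVUS : measurable (V `\` prodset U S : set (borel G)).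
  by apply: measurableD => //; exact: borel_open.
have muD : mu D <= (b + e * m)%:E.
  rewrite EFinD -bE; apply: le_trans (leeD (lexx _) muV).
  apply: (@le_trans _ _ (mu ((prodset U S `\` U) `|` (V `\` prodset U S)))).
    apply: le_measure; rewrite ?inE //; first exact: measurableU.
    move=> x /DVU[Vx nUx].
    by have [USx|nUSx] := pselect (prodset U S x); [left|right].
  exact: measureU2.
apply: (@le_trans _ _ (cheeger R X)).
  by apply: ereal_inf_lbound; exists X.
apply: (@le_trans _ _ (mu D / mu U')).
  by rewrite ratio; apply: ereal_inf_lbound; exists A.
have [d dE] : exists d, mu D = d%:E.
  exists (fine (mu D)); rewrite fineK // ge0_fin_numE //.
  exact: le_lt_trans muD (ltry _).
rewrite mE bE dE inver (gt_eqF m0) -EFinM -EFinD.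
have : m%:E <= mu U'.
  rewrite -mE; apply: le_measure; rewrite ?inE //.
  apply: borel_open; exact: (coset_map_open (stabiliser_subgroup act o)
    (stabiliser_open act o) (orbit_coset_map act tr o)).
case: (mu U') => [m'||]; last 2 first.
- by rewrite invey mule0 lee_fin addr_ge0 // ?divr_ge0 // ltW.
- by rewrite leeNy_eq.
rewrite lee_fin => mm'; have m'0 : (0 < m')%R by exact: lt_le_trans mm'.
rewrite inver (gt_eqF m'0) -EFinM lee_fin ler_pdivrMr //.
move: muD; rewrite dE lee_fin => /le_trans; apply.
have -> : (b + e * m = (b / m + e) * m)%R by field; rewrite gt_eqF.
by rewrite ler_wpM2l // addr_ge0 // ?divr_ge0 // ltW.
Qed.

Lemma cheeger_le_folner : cheeger_group R G <= folner_star mu.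
Proof.
apply: le_ereal_inf_tmp => _ [S [cS symS gS] <-].
apply: le_ereal_inf_tmp => _ [U [cU U0] <-].
exact: cheeger_le_ratio.
Qed.

End comparison.

Theorem theorem1p12 (R : realType) (G : topologicalGroupType)
    (mu : {measure set (borel G) -> \bar R}) :
  tdlc G -> compactly_generated G -> left_haar mu ->
  cheeger_group R G = folner_star mu.
Proof.
move=> tdG _ muH; apply/eqP; rewrite eq_le.
by rewrite cheeger_le_folner // folner_le_cheeger.
Qed.
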